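(* Let $f_Q$ be a probability density on $[0,1]$ with cumulative distribution function $F_Q(q)=\int_0^q f_Q(x)\,dx$, let $\lambda,p,d>0$ with $\rho:=\lambda(p+d)<1$, and for $x_d\in[0,1]$ let $V_{WC}=V_{WC}(x_d)$ be the stationary expected workload of the distributed waste collection system with collection point $x_d$, as given in the context. Then the location of the collection point optimizing the stationary workload is $$x_d^*:=\arg\min_{0\le x_d\le 1}V_{WC}(x_d)=\arg\min_{0\le x_d\le 1}\big[x_d-F_Q(x_d)\big],$$ i.e. the set of minimizers over $[0,1]$ of $V_{WC}$ coincides with the set of minimizers over $[0,1]$ of $x_d\mapsto x_d-F_Q(x_d)$.
   Context: **Distributed waste collection system.** A vehicle moves at unit speed in a fixed direction on a closed path of unit length, identified with $[0,1]$. Pickup requests arrive according to a Poisson process of rate $\lambda$, at i.i.d. positions on the path with density $f_Q$. When the vehicle encounters a waiting request it stops and picks up the item, which takes a fixed time $p$; the item must then be discarded at one fixed collection point $x_d\in[0,1]$, which takes a fixed time $d$ and is done the next time the vehicle reaches $x_d$. So each request requires two services: the first at its arrival position, the second at $x_d$. **Workload.** The stationary expected virtual workload (expected total service time required by all waiting requests, including their future services) of this system is $$ \begin{aligned} V_{WC}(x_d)={}&\frac{\rho\lambda(p^2+d^2)}{2(1-\rho)}+\frac{\rho\lambda pd}{1-\rho}+\frac{\rho}{2}+\frac{\lambda d}{1-\rho}\Big(x_d-\int_0^1 q f_Q(q)\,dq+1-F_Q(x_d)\Big)\\ &+\frac{\rho}{1-\rho}\int_0^1\!\!\int_0^1\lambda\Big(p\big(F_Q(y)-F_Q(q)+1_{\{y<q\}}\big)+d\big(1_{\{x_d\le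 y\}}-1_{\{x_d\le q\}}+1_{\{y<q\}}\big)\Big)f_Q(q)\,dq\,dy, \end{aligned} $$ where $\rho=\lambda(p+d)$. This explicit expression is to be taken as the definition of $V_{WC}(x_d)$. *)

(* Defs.v *)
From HB Require Import structures.
From mathcomp Require Import all_boot all_order all_algebra.
From mathcomp Require Import all_classical all_reals all_analysis.

Set Implicit Arguments.
Unset Strict Implicit.
Unset Printing Implicit Defensive.

Import Order.TTheory GRing.Theory Num.Theory.
Import numFieldNormedType.Exports.

Local Open Scope classical_set_scope.
Local Open Scope ring_scope.

Definition density01 (R : realType) (f : R -> R) : Prop :=
  [/\ measurable_fun `[(0 : R), 1] f,
      (forall x, x \in `[(0 : R), 1] -> 0 <= f x)
    & (\int[lebesgue_measure]_(x in `[0%R, 1%R]) (f x)%:E = 1)%E].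

Definition cdf01 (R : realType) (f : R -> R) (q : R) : R :=
  \int[lebesgue_measure]_(x in `[0, q]) f x.

(* [lam] is the arrival rate, [p] and [d] the durations of a pickup and of a
   disposal. *)
Definition load (R : realType) (lam p d : R) : R := lam * (p + d).

(* Stationary expected workload as a function of the collection point [xd];
   each comparison cast by [%:R] is an indicator. *)
Definition V_WC (R : realType) (f : R -> R) (lam p d xd : R) : R :=
  let mu := @lebesgue_measure R in
  let F := cdf01 f in
  let rho := load lam p d in
  rho * lam * (p ^+ 2 + d ^+ 2) / (2 * (1 - rho))
  + rho * lam * p * d / (1 - rho)
  + rho / 2
  + lam * d / (1 - rho)
    * (xd - (\int[mu]_(q in `[(0 : R), 1]) (q * f q)) + 1 - F xd)
  + rho / (1 - rho)
    * \int[mu]_(y in `[(0 : R), 1]) \int[mu]_(q in `[(0 : R), 1])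
        (lam * (p * (F y - F q + (y < q)%R%:R)
                + d * ((xd <= y)%R%:R - (xd <= q)%R%:R + (y < q)%R%:R))
         * f q).

Definition argmin_on (R : realType) (A : set R) (g : R -> R) : set R :=
  [set x | A x /\ forall y, A y -> g x <= g y].

(* Main.v *)
Require Import Defs.
From HB Require Import structures.
From mathcomp Require Import all_boot all_order all_algebra.
From mathcomp Require Import all_classical all_reals all_analysis.
From mathcomp Require Import measurable_realfun ring.

Set Implicit Arguments.
Unset Strict Implicit.
Unset Printing Implicit Defensive.

Import Order.TTheory GRing.Theory Num.Theory.
Import numFieldNormedType.Exports.

Local Open Scope classical_set_scope.
Local Open Scope ring_scope.

(* The double integral depends on [xd] only through
   [lam * d * \int_y \int_q (1_{xd <= y} - 1_{xd <= q}) f q], which equals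
   [lam * d * (F xd - xd)]. Hence the coefficient of [xd - F xd] in the
   workload is [lam * d * (1 / (1 - rho) - rho / (1 - rho)) = lam * d > 0], and
   the remaining terms do not depend on [xd]. *)

Lemma argmin_on_affine (R : realType) (A : set R) (g h : R -> R) (a c : R) :
  0 < a -> (forall x, A x -> g x = c + a * h x) ->
  argmin_on A g = argmin_on A h.
Proof.
move=> a0 gE; apply/seteqP; split=> x [Ax xmin]; split=> // y Ay;
  by have := xmin y Ay; rewrite !gE// lerD2l ler_pM2l.
Qed.

Section unit_interval.
Variable R : realType.
Implicit Types (f g h : R -> R) (x y : R).

Local Notation mu := (@lebesgue_measure R).
Local Notation I := (`[(0 : R), 1]%classic).
Local Notation intI f := (mu.-integrable I (EFin \o f)).

Lemma integrableZl_unit f (a : R) : intI f -> intI (fun q => a * f q).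
Proof. by move=> fi; apply: (integrableZl _ a fi). Qed.

Lemma integrableD_unit f g : intI f -> intI g -> intI (fun q => f q + g q).
Proof. by move=> fi gi; apply: (integrableD _ fi gi). Qed.

Lemma integrableM_unit h f : measurable_fun I h -> [bounded h q | q in I] ->
  intI f -> intI (fun q => h q * f q).
Proof.
move=> mh bh fi.
by have := @integrableMr _ _ R mu I _ h _ mh bh fi; apply.
Qed.

Lemma lebesgue_measure_unit : mu I = 1%E.
Proof. by rewrite lebesgue_measure_itv/= lte_fin ltr01 oppr0 adde0. Qed.

Lemma integrable_cst_unit (a : R) : intI (fun=> a).
Proof.
have muI : (mu I < +oo)%E by rewrite lebesgue_measure_unit ltry.
apply: (measurable_bounded_integrable _ muI) => //.
exists `|a|; split; first exact: num_real.
by move=> M aM q _ /=; exact: ltW.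
Qed.

Lemma Rintegral_cst_unit (a : R) : \int[mu]_(q in I) a = a.
Proof.
have -> : \int[mu]_(q in I) a = a * fine (mu I) by exact: Rintegral_cst.
by rewrite lebesgue_measure_unit mulr1.
Qed.

(** The flag [b] treats both indicators of the workload at once: [false] gives the strict [y < q],
    [true] the weak [xd <= q]. *)
Lemma integrable_lteif_unit f x (b : bool) : intI f ->
  intI (fun q => (x < q ?<= if b)%R%:R * f q).
Proof.
move=> fi; apply: integrableM_unit => //.
  have -> : (fun q => (x < q ?<= if b)%R%:R) =
            \1_[set` Interval (BSide b x) +oo%O] :> (R -> R).
    apply/funext => q; rewrite indicE mem_setE in_itv/= andbT.
    by case: b.
  exact: measurable_indic.
exists 1; split=> // M M1 q _ /=; case: (_ < _ ?<= if b); rewrite /= ?normr1 ?normr0 ltW//.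
exact: lt_trans M1.
Qed.

(** The indicator restricts the integral to the part of [I] beyond [x]. Whether [x] itself is
    included does not matter, since a point is Lebesgue-null. *)
Lemma Rintegral_lteif_unit f x (b : bool) : intI f -> I x ->
  \int[mu]_(q in I) ((x < q ?<= if b)%R%:R * f q)
  = \int[mu]_(q in I) f q - cdf01 f x.
Proof.
move=> fi /=; rewrite in_itv/= => /andP[x0 x1].
rewrite /cdf01 Rintegral_itvB// ?bnd_simp//.
transitivity (\int[mu]_(q in [set` Interval (BSide b x) (BRight 1)]) f q);
  last first.
  case: b => //; rewrite Rintegral_itv_obnd_cbnd//.
  apply: integrableS fi => // q /=.
  by rewrite !in_itv/= => /andP[xq ->]; rewrite (le_trans x0 (ltW xq)).
have -> : [set` Interval (BSide b x) (BRight 1)] =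
    I `&` [set` Interval (BSide b x) +oo%O].
  apply/seteqP; split=> q /=; rewrite !in_itv/= ?andbT.
    move=> /andP[xq ->]; rewrite andbT; split=> //.
    exact: le_trans x0 (lteifW xq).
  by move=> [/andP[_ ->] ->].
rewrite Rintegral_mkcondr; apply: eq_Rintegral => q _.
rewrite patchE mem_setE in_itv/= andbT.
by case: (_ < _ ?<= if b); rewrite ?mul1r ?mul0r.
Qed.

(** With the uniform density, [Rintegral_lteif_unit] also evaluates the integral of [1_{xd <= y}]
    over [y], as [1 - xd]. *)
Lemma cdf01_cst1 x : I x -> cdf01 (fun=> 1) x = x :> R.
Proof.
rewrite /= in_itv/= => /andP[x0 x1].
have -> : cdf01 (fun=> 1) x = 1 * fine (mu `[0, x]) by exact: Rintegral_cst.
rewrite lebesgue_measure_itv/= lte_fin mul1r.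
by case: ltgtP x0 => //= _ _; rewrite oppr0 addr0.
Qed.

(** Continuity on the compact [I] yields both the integrability of [F] and the boundedness that
    makes [F q * f q] integrable. *)
Lemma continuous_cdf01 f : intI f -> {within I, continuous (cdf01 f)}.
Proof. exact: parameterized_integral_continuous. Qed.

End unit_interval.
Arguments continuous_cdf01 {R f}.

Section workload.
Variables (R : realType) (f : R -> R).
Local Notation mu := (@lebesgue_measure R).
Local Notation I := (`[(0 : R), 1]%classic).
Local Notation F := (cdf01 f).

Hypothesis f_density : density01 f.

Lemma density01_integrable : mu.-integrable I (EFin \o f).
Proof.
case: f_density => mf f0 f1; apply/integrableP; split.
  exact/measurable_EFinP.
(* As [f] is nonnegative on [I], the integral of its absolute value is its total mass [1], hence
   finite. *)
under eq_integral => x xI.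
  rewrite /= ger0_norm; last by apply: f0; rewrite mem_setE in xI.
  over.
by rewrite f1 ltry.
Qed.

Lemma density01_Rintegral : \int[mu]_(q in I) f q = 1.
Proof. by case: f_density => _ _ f1; rewrite /Rintegral f1. Qed.

Lemma cdf01_integrable : mu.-integrable I (EFin \o F).
Proof.
apply: continuous_compact_integrable; first exact: segment_compact.
exact: continuous_cdf01 density01_integrable.
Qed.

Lemma cdf01M_integrable : mu.-integrable I (EFin \o (fun q => F q * f q)).
Proof.
have cF := continuous_cdf01 density01_integrable.
apply: integrableM_unit density01_integrable.
  by case/integrableP: cdf01_integrable => /measurable_EFinP.
have := continuous_compact cF (@segment_compact R 0 1).
move=> /compact_bounded [M [Mr HM]]; exists M; split=> // N MN q Iq.
by apply: (HM N MN); exists q.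
Qed.

(** Since [f] has mass [1], terms free of [q] come out unchanged, while [1_{y < q}] and
    [1_{xd <= q}] integrate to the tails [1 - F y] and [1 - F xd]. *)
Lemma inner_integral (lam p d xd y : R) : I xd -> I y ->
  \int[mu]_(q in I)
    (lam * (p * (F y - F q + (y < q)%R%:R)
            + d * ((xd <= y)%R%:R - (xd <= q)%R%:R + (y < q)%R%:R)) * f q)
  = lam * p * (F y - \int[mu]_(q in I) (F q * f q))
    + lam * (p + d) * (1 - F y)
    + lam * d * ((xd <= y)%R%:R - (1 - F xd)).
Proof.
move=> Ixd Iy; have fi := density01_integrable.
have Ffi := cdf01M_integrable.
have yi := integrable_lteif_unit y false fi.
have xi := integrable_lteif_unit xd true fi.
under eq_Rintegral => q _.
  rewrite (_ : _ * f q =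
    (lam * p * F y + lam * d * (xd <= y)%R%:R) * f q
    + (- (lam * p)) * (F q * f q)
    + (lam * (p + d)) * ((y < q ?<= if false)%R%:R * f q)
    + (- (lam * d)) * ((xd < q ?<= if true)%R%:R * f q)); last first.
    by rewrite /=; ring.
  over.
rewrite !RintegralD ?RintegralZl//; do ?apply: integrableD_unit;
  do ?exact: integrableZl_unit.
rewrite !Rintegral_lteif_unit// density01_Rintegral; ring.
Qed.

Lemma outer_integral (lam p d xd : R) : I xd ->
  \int[mu]_(y in I) \int[mu]_(q in I)
    (lam * (p * (F y - F q + (y < q)%R%:R)
            + d * ((xd <= y)%R%:R - (xd <= q)%R%:R + (y < q)%R%:R)) * f q)
  = lam * (p + d) - lam * p * \int[mu]_(q in I) (F q * f q)
    - lam * d * \int[mu]_(y in I) F y + lam * d * (F xd - xd).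
Proof.
move=> Ixd; have Fi := cdf01_integrable.
have c1i := @integrable_cst_unit R 1.
have xi := integrable_lteif_unit xd true c1i.
set c := \int[mu]_(q in I) (F q * f q).
(* The [F y] terms add up to [lam * p - lam * (p + d) = - (lam * d)] times [F y]. The factors [* 1]
   present the remaining terms as integrals against the uniform density. *)
under eq_Rintegral => y yI.
  rewrite inner_integral//; last by rewrite inE in yI.
  rewrite -/c (_ : _ + _ =
    (lam * (p + d) - lam * p * c - lam * d * (1 - F xd)) * 1
    + (- (lam * d)) * F y
    + (lam * d) * ((xd < y ?<= if true)%R%:R * 1)); last first.
    by rewrite /=; ring.
  over.
rewrite !RintegralD ?RintegralZl//; do ?apply: integrableD_unit;
  do ?exact: integrableZl_unit.
rewrite Rintegral_lteif_unit// Rintegral_cst_unit cdf01_cst1//; ring.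
Qed.

Lemma V_WC_affine (lam p d : R) : load lam p d < 1 ->
  exists c, forall xd, I xd -> V_WC f lam p d xd = c + lam * d * (xd - F xd).
Proof.
move=> rho1; have rhoN0 : 1 - load lam p d != 0 by rewrite subr_eq0 gt_eqF.
(* Evaluation at [xd = 0] forces this constant and avoids spelling out the terms free of [xd]. Once
   [outer_integral] is applied at both [xd] and [0], these terms cancel. *)
exists (V_WC f lam p d 0 - lam * d * (0 - F 0)) => xd Ixd.
have I0 : I 0 by rewrite /= in_itv/= lexx ler01.
rewrite /V_WC !outer_integral//.
by field.
Qed.

End workload.

Theorem lemma1 (R : realType) (fQ : R -> R) (lam p d : R)
    (hfQ : density01 fQ)
    (hlam : 0 < lam) (hp : 0 < p) (hd : 0 < d)
    (hrho : load lam p d < 1) :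
  argmin_on `[(0 : R), 1] (V_WC fQ lam p d)
  = argmin_on `[(0 : R), 1] (fun xd => xd - cdf01 fQ xd).
Proof.
have [c Vc] := V_WC_affine hfQ hrho.
exact: argmin_on_affine (mulr_gt0 hlam hd) Vc.
Qed.
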